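(* Let $m,\alpha,\beta$ be positive integers, and let $F_1\in \mathrm{Char}(m,\alpha)$, $F_2\in \mathrm{Char}(m,\beta)$. Then the pointwise tensor product $F_1\otimes F_2$ of matrix-valued functions, $(F_1\otimes F_2)(S)=F_1(S)\otimes F_2(S)$, belongs to $\mathrm{Char}(m,\alpha\beta)$.
   Context: $\mathrm{U}(n)$ is the group of unitary $n\times n$ matrices and $1_n$ the unit matrix of order $n$. $\mathrm{B}_n$ is the set of complex $n\times n$ matrices $z$ with Euclidean operator norm $\|z\|<1$. Tensor products of matrices are written with respect to the following order of the basis of $V\otimes W$ (where $e_1,\dots,e_p$ is a basis of $V$ and $f_1,\dots,f_q$ a basis of $W$): $e_1\otimes f_1,\dots,e_p\otimes f_1,\ e_1\otimes f_2,\dots,e_p\otimes f_2,\ \dots,\ e_1\otimes f_q,\dots,e_p\otimes f_q$. Characteristic functions: for an integer $j\ge 0$, let $g=\begin{pmatrix}a&b\\c&d\end{pmatrix}\in \mathrm{U}(\alpha+mj)$, with $a$ of size $\alpha\times\alpha$ and $d$ of size $mj\times mj$. For $S=(s_{\mu\nu})\in \mathrm{B}_m$ the matrix $1_j\otimes S$ is the $mj\times mj$ block matrix with $m\times m$ blocks, whose $(\mu,\nu)$ block is $s_{\mu\nu}1_j$. Put $$\Theta[g;S]=a+b\,(1_j\otimes S)\bigl(1_{mj}-d\,(1_j\otimes S)\bigr)^{-1}c .$$ (For $j=0$ this is the constant $a$.) $\mathrm{Char}(m,\alpha)$ is the set of all functions $S\mapsto \Theta[g;S]$ on $\mathrm{B}_m$,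 where $g\in \mathrm{U}(\alpha+mj)$ and $j=0,1,2,\dots$. *)

(* Defs.v *)
From HB Require Import structures.
From mathcomp Require Import all_boot all_order all_algebra.
From mathcomp Require Import boolp classical_sets reals.
From mathcomp Require Import complex mxtens.

Set Implicit Arguments.
Unset Strict Implicit.
Unset Printing Implicit Defensive.

Import Order.TTheory GRing.Theory Num.Theory.
Local Open Scope classical_set_scope.
Local Open Scope ring_scope.
Local Open Scope complex_scope.

Definition euclid_norm (R : realType) (n : nat) (x : 'cV[R[i]]_n) : R :=
  Num.sqrt (\sum_(k < n) ComplexField.Normc.normc (x k 0) ^+ 2).

(* The set below is bounded above, so the default value of [sup] (which is 0
   on unbounded sets) plays no role. *)
Definition op_norm (R : realType) (n : nat) (z : 'M[R[i]]_n) : R :=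
  sup [set euclid_norm (z *m x) | x in [set x | euclid_norm x <= 1]].

Definition matrix_ball (R : realType) (m : nat) : set 'M[R[i]]_m :=
  [set z | op_norm z < 1].

Arguments matrix_ball : clear implicits.

(* A (x) B in the basis e_1 (x) f_1, ..., e_p (x) f_1, e_1 (x) f_2, ...: the
   index of the left factor varies fastest, so B supplies the blocks.  In
   [*t] it is the index of the right factor that varies fastest. *)
Definition tens (C : comPzRingType) (p q : nat) (A : 'M[C]_p) (B : 'M[C]_q) :
  'M[C]_(q * p) := B *t A.

(* For unitary g and S in the ball, |d T| < 1, so the inverse is a genuine one. *)
Definition Theta (C : fieldType) (m alpha j : nat)
    (g : 'M[C]_(alpha + m * j)) (S : 'M[C]_m) : 'M[C]_alpha :=
  let a := ulsubmx g in let b := ursubmx g in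
  let c := dlsubmx g in let d := drsubmx g in
  let T : 'M[C]_(m * j) := tens (1%:M : 'M[C]_j) S in
  a + b *m T *m invmx (1%:M - d *m T) *m c.

Definition Char (R : realType) (m alpha : nat) :
    set (matrix_ball R m -> 'M[R[i]]_alpha) :=
  [set F | exists (j : nat) (g : 'M[R[i]]_(alpha + m * j)),
     g \is unitarymx /\ F = (fun S : matrix_ball R m => Theta g (val S))].

Arguments Char : clear implicits.

(* Main.v *)
Require Import Defs.
From mathcomp Require Import all_boot all_order all_algebra.
From mathcomp Require Import boolp classical_sets reals.
From mathcomp Require Import complex mxtens.

(** The class [Char R m n] is closed under pointwise products and under the two
    ampliations [F |-> F *t 1] and [F |-> 1 *t F]; since
    [F2 *t F1 = (F2 *t 1) *m (1 *t F1)], it is closed under tensor products.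

    A transfer function is handled through its feedback equations rather than
    through the formula with an inverse.  With [T = S *t 1], a unitary [g] of
    size [n + m * j] has [Theta g S = Y] exactly when some state [X] satisfies
    [g *m col_mx 1 (T *m X) = col_mx Y X] ([Theta_feedback]).  The equations
    determine [Y] because [1 - d *m T] is invertible: a vector fixed by
    [d *m T] would have to be shorter than itself, as [T] strictly shortens
    nonzero vectors when the operator norm of [S] is below 1
    ([tens1_contracts]) and a block [d] of a unitary matrix lengthens none
    ([resolvent_unit]).

    To show that a function belongs to the class it then suffices to exhibit a
    unitary matrix and states solving the equations, and the coordinates of the
    state space may be permuted at will ([Char_of_feedback]).
    - Product ([Char_mul]): feed the output of the second system into the
      first.  On the sum of the two state spaces this cascade is the product
      [G1 *m G2], where each [Gi] acts as [gi] on the input and on its own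
      states, and as the identity on the states of the other system.
    - Ampliation ([Char_amplify]): tensoring with an identity matrix respects
      sums, products, units and adjoints, so it carries the equations of [F],
      and the unitarity of [g], block by block to those of the ampliation.  It
      also turns [S *t 1] into [S *t 1] up to a reordering of the basis. *)

Set Implicit Arguments.
Unset Strict Implicit.
Unset Printing Implicit Defensive.

Import Order.TTheory GRing.Theory Num.Theory.
Local Open Scope ring_scope.
Local Open Scope complex_scope.
Local Open Scope sesquilinear_scope.

Local Notation normc := ComplexField.Normc.normc.

(** * Contractions and invertibility of the resolvent *)

Section EuclideanNorm.
Variable R : realType.
Local Notation C := R[i].

Definition sqnorm n (x : 'cV[C]_n) : R := \sum_(k < n) normc (x k 0) ^+ 2.

Lemma sqnorm_ge0 n (x : 'cV[C]_n) : 0 <= sqnorm x.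
Proof. by apply: sumr_ge0 => k _; rewrite sqr_ge0. Qed.

Lemma normc_ge0 (z : C) : 0 <= normc z.
Proof. by case: z => a b; exact: sqrtr_ge0. Qed.

Lemma sqnorm_eq0 n (x : 'cV[C]_n) : (sqnorm x == 0) = (x == 0).
Proof.
apply/eqP/eqP => [x0|->]; last first.
  by apply: big1 => k _; rewrite mxE ComplexField.Normc.normc0 expr0n.
apply/colP => k; rewrite mxE; apply: ComplexField.Normc.eq0_normc.
apply/eqP; rewrite -sqrf_eq0; apply/eqP.
by apply: (psumr_eq0P _ x0) => // i _; rewrite sqr_ge0.
Qed.

Lemma sqnormE n (x : 'cV[C]_n) : (x^t* *m x) 0 0 = (sqnorm x)%:C.
Proof.
rewrite mxE /sqnorm rmorph_sum; apply: eq_bigr => k _.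
by rewrite !mxE mulrC -normCK rmorphXn.
Qed.

Lemma sqnormZ n (a : R) (x : 'cV[C]_n) : sqnorm (a%:C *: x) = a ^+ 2 * sqnorm x.
Proof.
rewrite /sqnorm mulr_sumr; apply: eq_bigr => k _.
rewrite mxE ComplexField.Normc.normcM exprMn; congr (_ * _).
by rewrite /= expr0n addr0 sqr_sqrtr ?sqr_ge0.
Qed.

Lemma euclid_norm_le1 n (x : 'cV[C]_n) : (euclid_norm x <= 1) = (sqnorm x <= 1).
Proof. by rewrite /euclid_norm -{1}sqrtr1 ler_sqrt ?ler01. Qed.

(** Boundedness of the set whose supremum is [op_norm z]; without it [sup]
    would say nothing about individual values.  The bound is crude: every
    coordinate of [x] has modulus at most 1. *)
Lemma euclid_norm_bounded n (z : 'M[C]_n) :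
  has_ubound [set euclid_norm (z *m x) | x in [set x | euclid_norm x <= 1]]%classic.
Proof.
exists (Num.sqrt (\sum_i (\sum_k normc (z i k)) ^+ 2)) => _ [x /= x1 <-].
rewrite euclid_norm_le1 in x1; rewrite /euclid_norm ler_sqrt; last first.
  by apply: sumr_ge0 => i _; rewrite sqr_ge0.
have xk1 k : normc (x k 0) <= 1.
  rewrite -(@expr_le1 _ 2) ?normc_ge0//; apply: le_trans x1.
  by rewrite /sqnorm (bigD1 k)//= lerDl sumr_ge0// => i _; rewrite sqr_ge0.
apply: ler_sum => i _; rewrite lerXn2r ?nnegrE ?normc_ge0//.
  by apply: sumr_ge0 => k _; rewrite normc_ge0.
rewrite mxE.
apply: (@le_trans _ _ (\sum_k normc (z i k * x k 0))).
  elim/big_rec2: _ => [|k a b _ le]; first by rewrite ComplexField.Normc.normc0.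
  by apply: le_trans (le_normcD _ _) _; rewrite lerD2l.
apply: ler_sum => k _; rewrite ComplexField.Normc.normcM.
by rewrite ler_piMr ?normc_ge0.
Qed.

(** By homogeneity it is enough to look at the unit vector [r *: x], whose image
    has a norm that is one of the values below the supremum. *)
Lemma op_norm_lt1_contracts n (z : 'M[C]_n) (x : 'cV[C]_n) :
  op_norm z < 1 -> x != 0 -> sqnorm (z *m x) < sqnorm x.
Proof.
move=> z1 x0; have x_gt0 : 0 < sqnorm x by rewrite lt_def sqnorm_eq0 x0 sqnorm_ge0.
pose r := (Num.sqrt (sqnorm x))^-1.
have r2 : r ^+ 2 = (sqnorm x)^-1 by rewrite exprVn sqr_sqrtr ?sqnorm_ge0.
have : euclid_norm (z *m (r%:C *: x)) < 1.
  apply: le_lt_trans z1; apply: ub_le_sup; first exact: euclid_norm_bounded.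
  exists (r%:C *: x) => //=.
  by rewrite euclid_norm_le1 sqnormZ r2 mulVf ?lt0r_neq0.
rewrite /euclid_norm -[X in _ < X]sqrtr1 ltr_sqrt ?ltr01// -scalemxAr.
by rewrite -/(sqnorm _) sqnormZ r2 ltr_pdivrMl// mulr1.
Qed.

Lemma sum_mxtens_index (V : nmodType) m n (F : 'I_(m * n) -> V) :
  \sum_k F k = \sum_i \sum_j F (mxtens_index (i, j)).
Proof.
rewrite pair_big (reindex (@mxtens_index m n)) /=.
  by apply: eq_bigr => -[].
by exists (@mxtens_unindex m n) => k _; rewrite ?mxtens_indexK ?mxtens_unindexK.
Qed.

(** The matrix [S *t 1] acts by [S] separately on the [j] slices
    [xs k] of [x], at least one of which is nonzero. *)
Lemma tens1_contracts m j (S : 'M[C]_m) (x : 'cV[C]_(m * j)) :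
  op_norm S < 1 -> x != 0 -> sqnorm ((S *t (1%:M : 'M_j)) *m x) < sqnorm x.
Proof.
move=> S1 x0; pose xs k := \col_i x (mxtens_index (i, k)) 0 : 'cV[C]_m.
have E (y : 'cV[C]_(m * j)) :
    sqnorm y = \sum_k sqnorm (\col_i y (mxtens_index (i, k)) 0).
  rewrite /sqnorm sum_mxtens_index exchange_big; apply: eq_bigr => k _.
  by apply: eq_bigr => i _; rewrite mxE.
have Sxs k : \col_i ((S *t (1%:M : 'M_j)) *m x) (mxtens_index (i, k)) 0
    = S *m xs k.
  apply/colP => i; rewrite !mxE sum_mxtens_index; apply: eq_bigr => i' _.
  rewrite (bigD1 k)//= big1 => [|k' k'k]; rewrite tensmxE !mxE.
    by rewrite eqxx mulr1 addr0.
  by rewrite eq_sym (negPf k'k) mulr0 mul0r.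
rewrite !E; under eq_bigr do rewrite Sxs.
have [k xk0] : exists k, xs k != 0.
  apply/existsP; apply: contraNT x0; rewrite negb_exists => /forallP xs0.
  apply/eqP/colP => l; case: (mxtens_indexP l) => i k.
  by have /eqP/colP/(_ i) := negPn (xs0 k); rewrite !mxE.
rewrite (bigD1 k)//= [X in _ < X](bigD1 k)//=; apply: ltr_leD.
  exact: op_norm_lt1_contracts.
apply: ler_sum => l _; have [xl0|/(op_norm_lt1_contracts S1)/ltW//] := eqVneq (xs l) 0.
by rewrite -/(xs l) xl0 mulmx0.
Qed.

Lemma sqnorm_col n p (x : 'cV[C]_n) (y : 'cV[C]_p) :
  sqnorm (col_mx x y) = sqnorm x + sqnorm y.
Proof.
by rewrite /sqnorm big_split_ord; congr (_ + _); apply: eq_bigr => i _;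
  rewrite ?col_mxEu ?col_mxEd.
Qed.

Lemma unitary_adjoint_mul n (g : 'M[C]_n) : g \is unitarymx -> g^t* *m g = 1%:M.
Proof. by move=> /unitarymxP /mulmx1C. Qed.

Lemma sqnorm_unitary n (g : 'M[C]_n) (x : 'cV[C]_n) :
  g \is unitarymx -> sqnorm (g *m x) = sqnorm x.
Proof.
move=> /unitary_adjoint_mul gg; apply: (@complexI R).
rewrite -!sqnormE trmx_mul map_mxM -mulmxA (mulmxA _ g) gg mul1mx.
by [].
Qed.

(** If [x = d *m T *m x] with [x != 0], then [x] is the lower half of the image
    under the isometry [g] of [(0, T *m x)], a vector strictly shorter than
    [x]. *)
Lemma resolvent_unit n p (g : 'M[C]_(n + p)) (T : 'M[C]_p) :
    g \is unitarymx ->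
    (forall x : 'cV[C]_p, x != 0 -> sqnorm (T *m x) < sqnorm x) ->
  1%:M - drsubmx g *m T \in unitmx.
Proof.
move=> gU Tlt.
(* [kermx] is a row kernel, whereas a column in the kernel is wanted: transpose. *)
rewrite -unitmx_tr -row_free_unit -kermx_eq0.
apply/eqP/row_matrixP => i; rewrite row0; apply/eqP/negP => /negP v0.
pose x := (row i (kermx (1%:M - drsubmx g *m T)^T))^T.
have x0 : x != 0 by rewrite /x -(inj_eq (can_inj (@trmxK _ _ _))) trmxK trmx0.
have xE : x = drsubmx g *m (T *m x).
  apply/eqP; rewrite mulmxA -subr_eq0 -{1}[x]mul1mx -mulmxBl.
  rewrite -(inj_eq (can_inj (@trmxK _ _ _))) trmx_mul trmxK trmx0.
  by rewrite -row_mul mulmx_ker row0.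
have := Tlt _ x0; apply/negP; rewrite -leNgt {1}xE.
have -> : sqnorm (T *m x) = sqnorm (g *m col_mx 0 (T *m x)).
  by rewrite (sqnorm_unitary _ gU) sqnorm_col [X in X + _](_ : _ = 0) ?add0r//;
     apply/eqP; rewrite sqnorm_eq0.
rewrite -{2}[g]submxK mul_block_col !mulmx0 !add0r sqnorm_col.
by rewrite lerDr sqnorm_ge0.
Qed.

End EuclideanNorm.

(** * Transfer functions as solutions of the feedback equations *)

Section Characteristic.
Variables (R : realType) (m : nat).
Local Notation C := R[i].
Local Notation ball := (matrix_ball R m).

(** Eliminating [X] from the lower equation [c + d *m T *m X = X] gives the
    resolvent, and substituting it in the upper one gives [Theta g S]. *)
Lemma Theta_feedback n j (g : 'M[C]_(n + m * j)) (S : 'M[C]_m)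
    (Y : 'M[C]_n) (X : 'M[C]_(m * j, n)) :
    g \is unitarymx -> op_norm S < 1 ->
  g *m col_mx 1%:M ((S *t 1%:M) *m X) = col_mx Y X <->
  Y = Theta g S /\
  X = invmx (1%:M - drsubmx g *m (S *t 1%:M)) *m dlsubmx g.
Proof.
move=> gU S1; have U : 1%:M - drsubmx g *m (S *t (1%:M : 'M_j)) \in unitmx.
  by apply: resolvent_unit => // x; exact: tens1_contracts.
rewrite -{1}[g]submxK mul_block_col !mulmx1 /Theta /tens.
split=> [/eq_col_mx[YE XE]|[-> ->]].
  suff XE' : X = invmx (1%:M - drsubmx g *m (S *t 1%:M)) *m dlsubmx g.
    by rewrite -YE XE' !mulmxA.
  apply: (canRL (mulKmx U)); rewrite mulmxBl mul1mx -mulmxA -{1}XE.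
  by rewrite addrK.
have := mulKVmx U (dlsubmx g).
set X' : 'M_(m * j, n) := invmx _ *m _.
rewrite mulmxBl mul1mx => XE; rewrite [drsubmx g *m (_ *m X')]mulmxA -{1}XE subrK.
by rewrite !mulmxA.
Qed.

Lemma Char_feedback n (F : ball -> 'M[C]_n) :
  Char R m n F <->
  exists j (g : 'M[C]_(n + m * j)), g \is unitarymx /\
    forall S : ball, exists X,
      g *m col_mx 1%:M ((val S *t 1%:M) *m X) = col_mx (F S) X.
Proof.
split=> -[j [g [gU FE]]]; exists j, g; split=> //.
  move=> S; exists (invmx (1%:M - drsubmx g *m (val S *t 1%:M)) *m dlsubmx g).
  by apply/Theta_feedback => //; [exact: set_valP S|rewrite FE].
apply/funext => S; have [X] := FE S.
by move=> /(Theta_feedback _ _ gU (set_valP S))[].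
Qed.

Lemma mxsub_mul_bij n p q r s t (f : 'I_r -> 'I_n) (h : 'I_s -> 'I_p)
    (k : 'I_t -> 'I_q) (A : 'M[C]_(n, p)) (B : 'M[C]_(p, q)) :
  bijective h -> mxsub f h A *m mxsub h k B = mxsub f k (A *m B).
Proof.
move=> hbij; apply/matrixP => i l; rewrite !mxE.
rewrite [RHS](reindex h); last exact: onW_bij.
by apply: eq_bigr => i' _; rewrite !mxE.
Qed.

Lemma mxsub_unitary n p (h : 'I_n -> 'I_p) (g : 'M[C]_p) :
  bijective h -> g \is unitarymx -> mxsub h h g \is unitarymx.
Proof.
move=> hbij /unitarymxP gU; apply/unitarymxP.
rewrite trmx_mxsub map_mxsub mxsub_mul_bij// gU.
by apply/matrixP => i l; rewrite !mxE (inj_eq (bij_inj hbij)).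
Qed.

(** The map between bases of input plus state spaces that fixes the inputs and
    renames the states by [f]. *)
Definition extend_index n p q (f : 'I_p -> 'I_q) (k : 'I_(n + p)) : 'I_(n + q) :=
  match split k with inl a => lshift q a | inr b => rshift n (f b) end.
Arguments extend_index n {p q} f k.

Lemma extend_index_bij n p q (f : 'I_p -> 'I_q) :
  bijective f -> bijective (extend_index n f).
Proof.
move=> [f' fK f'K]; exists (extend_index n f') => k; rewrite /extend_index;
  by case: (split_ordP k) => i ->; rewrite ?(unsplitK (inl _)) ?(unsplitK (inr _)) ?fK ?f'K.
Qed.

Lemma rowsub_extend_index n p q r (f : 'I_p -> 'I_q)
    (U : 'M[C]_(n, r)) (V : 'M[C]_(q, r)) :
  rowsub (extend_index n f) (col_mx U V) = col_mx U (rowsub f V).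
Proof.
apply/matrixP => k l; rewrite mxE /extend_index; case: (split_ordP k) => i ->.
  by rewrite !col_mxEu.
by rewrite !col_mxEd mxE.
Qed.

(** The criterion used for all constructions.  The state space may be any
    [C^N] on which [S] acts by a matrix [T S] that becomes [S *t 1] after
    the basis is reordered by [f]; conjugating [G] by the same reordering keeps
    it unitary and yields a matrix of the shape prescribed by [Char]. *)
Lemma Char_of_feedback n N (F : ball -> 'M[C]_n) j (f : 'I_(m * j) -> 'I_N)
    (G : 'M[C]_(n + N)) (T : ball -> 'M[C]_N) :
    bijective f -> G \is unitarymx ->
    (forall S, val S *t 1%:M = mxsub f f (T S)) ->
    (forall S, exists X, G *m col_mx 1%:M (T S *m X) = col_mx (F S) X) ->
  Char R m n F.
Proof.
move=> fbij GU TE GF; have hbij := extend_index_bij n fbij.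
apply/Char_feedback; exists j, (mxsub (extend_index n f) (extend_index n f) G).
split=> [|S]; first exact: mxsub_unitary.
have [X GX] := GF S; exists (rowsub f X).
rewrite TE (mxsub_mul_bij f id)// -(rowsub_extend_index f).
by rewrite mxsub_mul_bij// GX rowsub_extend_index.
Qed.

(** * Products: cascade connection *)

(** The reordering of bases behind the distributivity of the tensor product of
    [C^m] over the direct sum of [C^j1] and [C^j2]. *)
Definition sum_state j1 j2 (k : 'I_(m * (j1 + j2))) : 'I_(m * j1 + m * j2) :=
  let: (i, l) := mxtens_unindex k in
  match split l with
  | inl a => lshift (m * j2) (mxtens_index (i, a))
  | inr b => rshift (m * j1) (mxtens_index (i, b))
  end.

Lemma sum_state_bij j1 j2 : bijective (@sum_state j1 j2).
Proof.
exists (fun k => match split k with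
  | inl a => let: (i, l) := mxtens_unindex a in mxtens_index (i, lshift j2 l)
  | inr b => let: (i, l) := mxtens_unindex b in mxtens_index (i, rshift j1 l)
  end) => k; rewrite /sum_state.
  case: (mxtens_indexP k) => i l; rewrite mxtens_indexK.
  by case: (split_ordP l) => a ->;
    rewrite ?(unsplitK (inl _)) ?(unsplitK (inr _)) mxtens_indexK.
case: (split_ordP k) => a ->; rewrite ?(unsplitK (inl _)) ?(unsplitK (inr _));
  case: (mxtens_indexP a) => i l;
  by rewrite !mxtens_indexK ?(unsplitK (inl _)) ?(unsplitK (inr _)).
Qed.

Lemma tens1_sum j1 j2 (S : 'M[C]_m) :
  S *t (1%:M : 'M_(j1 + j2)) = mxsub (@sum_state j1 j2) (@sum_state j1 j2)
    (block_mx (S *t (1%:M : 'M_j1)) 0 0 (S *t (1%:M : 'M_j2))).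
Proof.
apply/matrixP => k k'; rewrite [RHS]mxE /sum_state.
case: (mxtens_indexP k) => i l; case: (mxtens_indexP k') => i' l'.
rewrite tensmxE !mxtens_indexK scalar_mx_block.
by case: (split_ordP l) => a ->; case: (split_ordP l') => a' ->;
  rewrite ?(block_mxEul, block_mxEur, block_mxEdl, block_mxEdr) ?tensmxE//
    !mxE mulr0.
Qed.

Lemma block_unitary_eqs n p (a : 'M[C]_n) (b : 'M[C]_(n, p)) (c : 'M[C]_(p, n))
    (d : 'M[C]_p) :
  block_mx a b c d \is unitarymx <->
  [/\ a *m a^t* + b *m b^t* = 1%:M, a *m c^t* + b *m d^t* = 0,
      c *m a^t* + d *m b^t* = 0 & c *m c^t* + d *m d^t* = 1%:M].
Proof.
have E : block_mx a b c d *m (block_mx a b c d)^t* =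
    block_mx (a *m a^t* + b *m b^t*) (a *m c^t* + b *m d^t*)
             (c *m a^t* + d *m b^t*) (c *m c^t* + d *m d^t*).
  by rewrite tr_block_mx map_block_mx mulmx_block.
split=> [/unitarymxP|[e1 e2 e3 e4]].
  by rewrite E scalar_mx_block => /eq_block_mx.
by apply/unitarymxP; rewrite E e1 e2 e3 e4 -scalar_mx_block.
Qed.

(** The state of the cascade is [(X1 *m F2 S, X2)]: the second system receives the
    input [1], and the first one receives [F2 S] in place of [1], so that its
    equations get multiplied by [F2 S] on the right. *)
Lemma Char_mul n (F1 F2 : ball -> 'M[C]_n) :
  Char R m n F1 -> Char R m n F2 -> Char R m n (fun S => F1 S *m F2 S).
Proof.
move=> /Char_feedback[j1 [g1 [g1U F1E]]] /Char_feedback[j2 [g2 [g2U F2E]]].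
move: g1U F1E g2U F2E; rewrite -[g1]submxK -[g2]submxK.
set a1 := ulsubmx g1; set b1 := ursubmx g1.
set c1 := dlsubmx g1; set d1 := drsubmx g1.
set a2 := ulsubmx g2; set b2 := ursubmx g2.
set c2 := dlsubmx g2; set d2 := drsubmx g2.
move=> g1U F1E g2U F2E.
pose G1 := block_mx a1 (row_mx b1 (0 : 'M_(n, m * j2)))
  (col_mx c1 (0 : 'M_(m * j2, n))) (block_mx d1 0 0 1%:M).
pose G2 := block_mx a2 (row_mx (0 : 'M_(n, m * j1)) b2)
  (col_mx (0 : 'M_(m * j1, n)) c2) (block_mx 1%:M 0 0 d2).
have G1U : G1 \is unitarymx.
  have [e1 e2 e3 e4] := (block_unitary_eqs _ _ _ _).1 g1U.
  apply/block_unitary_eqs; rewrite tr_block_mx tr_row_mx tr_col_mx.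
  rewrite map_block_mx map_row_mx map_col_mx !(trmx0, map_mx0, trmx1, map_mx1).
  rewrite mulmx_block mul_block_col mul_row_block mul_col_row.
  rewrite mul_row_col mul_mx_row mul_col_mx !(mulmx0, mul0mx, addr0, add0r, mulmx1).
  rewrite add_row_mx add_col_mx add_block_mx !(addr0, add0r) e1 e2 e3 e4.
  by rewrite row_mx0 col_mx0 -scalar_mx_block.
have G2U : G2 \is unitarymx.
  have [e1 e2 e3 e4] := (block_unitary_eqs _ _ _ _).1 g2U.
  apply/block_unitary_eqs; rewrite tr_block_mx tr_row_mx tr_col_mx.
  rewrite map_block_mx map_row_mx map_col_mx !(trmx0, map_mx0, trmx1, map_mx1).
  rewrite mulmx_block mul_block_col mul_row_block mul_col_row.
  rewrite mul_row_col mul_mx_row mul_col_mx !(mulmx0, mul0mx, addr0, add0r, mulmx1).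
  rewrite add_row_mx add_col_mx add_block_mx !(addr0, add0r) e1 e2 e3 e4.
  by rewrite row_mx0 col_mx0 -scalar_mx_block.
have GU := mul_unitarymx G1U G2U.
apply: (@Char_of_feedback _ _ _ _ (@sum_state j1 j2) (G1 *m G2)
  (fun S => block_mx (val S *t 1%:M) 0 0 (val S *t 1%:M))).
- exact: sum_state_bij.
- exact: GU.
- by move=> S; exact: tens1_sum.
move=> S; have [X1 E1] := F1E S; have [X2 E2] := F2E S.
exists (col_mx (X1 *m F2 S) X2).
have -> : block_mx (val S *t 1%:M) 0 0 (val S *t 1%:M) *m col_mx (X1 *m F2 S) X2 =
    col_mx (val S *t 1%:M *m (X1 *m F2 S)) (val S *t 1%:M *m X2).
  by rewrite mul_block_col !mul0mx addr0 add0r.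
rewrite -mulmxA.
rewrite mul_block_col !mulmx1 in E1; rewrite mul_block_col !mulmx1 in E2.
have [E11 E12] := eq_col_mx E1; have [E21 E22] := eq_col_mx E2.
have -> : G2 *m col_mx 1%:M (col_mx (val S *t 1%:M *m (X1 *m F2 S))
    (val S *t 1%:M *m X2)) =
  col_mx (F2 S) (col_mx (val S *t 1%:M *m (X1 *m F2 S)) X2).
  rewrite mul_block_col mul_block_col mul_row_col mul_col_mx !mulmx1.
  by rewrite !mul0mx mul1mx !(addr0, add0r) add_col_mx E21 E22 add0r.
rewrite mul_block_col mul_block_col mul_row_col mul_col_mx.
rewrite !mul0mx mul1mx !(addr0, add0r) add_col_mx add0r.
have -> : a1 *m F2 S + b1 *m (val S *t 1%:M *m (X1 *m F2 S)) = F1 S *m F2 S.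
  by rewrite -E11 mulmxDl !mulmxA.
suff -> : c1 *m F2 S + d1 *m (val S *t 1%:M *m (X1 *m F2 S)) = X1 *m F2 S by [].
by rewrite -[X in _ = X *m _]E12 mulmxDl !mulmxA.
Qed.

(** * Ampliations *)

(** Left and right tensoring by an identity matrix are treated at once: [phi]
    stands for either, and the last hypothesis asks that the ampliation of
    [S *t 1] be again of this form in a suitable basis. *)
Lemma Char_amplify (r : nat -> nat)
    (phi : forall p q, 'M[C]_(p, q) -> 'M[C]_(r p, r q)) :
    (forall p q (A B : 'M_(p, q)), phi _ _ (A + B) = phi _ _ A + phi _ _ B) ->
    (forall p q s (A : 'M_(p, q)) (B : 'M_(q, s)),
       phi _ _ (A *m B) = phi _ _ A *m phi _ _ B) ->
    (forall p, phi p p 1%:M = 1%:M) ->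
    (forall p q (A : 'M_(p, q)), phi _ _ (A^t*) = (phi _ _ A)^t*) ->
    (forall j, exists k (f : 'I_(m * k) -> 'I_(r (m * j)%N)), bijective f /\
       forall S : 'M[C]_m,
         S *t (1%:M : 'M_k) = mxsub f f (phi _ _ (S *t (1%:M : 'M_j)))) ->
  forall n (F : ball -> 'M[C]_n),
  Char R m n F -> Char R m (r n) (fun S => phi _ _ (F S)).
Proof.
move=> phiD phiM phi1 phiA phiT n F /Char_feedback[j [g [gU FE]]].
have phi0 p q : phi p q 0 = 0.
  by apply: (addrI (phi p q 0)); rewrite -phiD !addr0.
have [k [f [fbij fE]]] := phiT j.
move: gU FE; rewrite -[g]submxK.
set a := ulsubmx g; set b := ursubmx g; set c := dlsubmx g; set d := drsubmx g.
move=> /block_unitary_eqs[e1 e2 e3 e4] FE.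
apply: (@Char_of_feedback _ _ _ _ f
  (block_mx (phi _ _ a) (phi _ _ b) (phi _ _ c) (phi _ _ d))
  (fun S => phi _ _ (val S *t 1%:M))) => //.
- apply/block_unitary_eqs; rewrite -!phiA -!phiM -!phiD e1 e2 e3 e4.
  by rewrite !phi0 !phi1.
- move=> S; have [X] := FE S; rewrite mul_block_col !mulmx1 => /eq_col_mx[EY EX].
  by exists (phi _ _ X); rewrite mul_block_col !mulmx1 -!phiM -!phiD EY EX.
Qed.

Lemma tensmx11 p q : (1%:M : 'M[C]_p) *t (1%:M : 'M_q) = 1%:M.
Proof.
apply/matrixP => k l; case: (mxtens_indexP k) => i u; case: (mxtens_indexP l) => j v.
rewrite tensmxE !mxE (inj_eq (can_inj (@mxtens_indexK p q))) xpair_eqE.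
by rewrite -natrM mulnb.
Qed.

Lemma Char_tens1 n q (F : ball -> 'M[C]_n) :
  Char R m n F -> Char R m (n * q) (fun S => F S *t (1%:M : 'M_q)).
Proof.
apply: (@Char_amplify (fun p => p * q)%N (fun _ _ A => A *t (1%:M : 'M_q))).
- by move=> p s A B; apply/matrixP => k l; rewrite !mxE mulrDl.
- by move=> p s t A B; rewrite tensmx_mul mulmx1.
- by move=> p; rewrite tensmx11.
- by move=> p s A; rewrite trmx_tens map_mxT trmx1 map_mx1.
(* the states are regrouped as [(i, (u, v)) |-> ((i, u), v)] *)
move=> j; exists (j * q)%N, (fun k =>
  let: (i, l) := mxtens_unindex k in let: (u, v) := mxtens_unindex l in
  mxtens_index (mxtens_index (i, u), v)); split.
  exists (fun k => let: (l, v) := mxtens_unindex k in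
    let: (i, u) := mxtens_unindex l in mxtens_index (i, mxtens_index (u, v))) => k.
    case: (mxtens_indexP k) => i l; case: (mxtens_indexP l) => u v.
    by rewrite !mxtens_indexK.
  case: (mxtens_indexP k) => l v; case: (mxtens_indexP l) => i u.
  by rewrite !mxtens_indexK.
move=> S; rewrite -tensmx11; apply/matrixP => k k'.
case: (mxtens_indexP k) => i l; case: (mxtens_indexP l) => u v.
case: (mxtens_indexP k') => i' l'; case: (mxtens_indexP l') => u' v'.
by rewrite [RHS]mxE; rewrite !mxtens_indexK; rewrite !tensmxE mulrA.
Qed.

Lemma Char_1tens n q (F : ball -> 'M[C]_n) :
  Char R m n F -> Char R m (q * n) (fun S => (1%:M : 'M_q) *t F S).
Proof.
apply: (@Char_amplify (fun p => q * p)%N (fun _ _ A => (1%:M : 'M_q) *t A)).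
- by move=> p s A B; apply/matrixP => k l; rewrite !mxE mulrDr.
- by move=> p s t A B; rewrite tensmx_mul mulmx1.
- by move=> p; rewrite tensmx11.
- by move=> p s A; rewrite trmx_tens map_mxT trmx1 map_mx1.
(* the new factor moves past [C^m]: [(i, (u, v)) |-> (u, (i, v))] *)
move=> j; exists (q * j)%N, (fun k =>
  let: (i, l) := mxtens_unindex k in let: (u, v) := mxtens_unindex l in
  mxtens_index (u, mxtens_index (i, v))); split.
  exists (fun k => let: (u, l) := mxtens_unindex k in
    let: (i, v) := mxtens_unindex l in mxtens_index (i, mxtens_index (u, v))) => k.
    case: (mxtens_indexP k) => i l; case: (mxtens_indexP l) => u v.
    by rewrite !mxtens_indexK.
  case: (mxtens_indexP k) => l v; case: (mxtens_indexP v) => i u.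
  by rewrite !mxtens_indexK.
move=> S; rewrite -tensmx11; apply/matrixP => k k'.
case: (mxtens_indexP k) => i l; case: (mxtens_indexP l) => u v.
case: (mxtens_indexP k') => i' l'; case: (mxtens_indexP l') => u' v'.
by rewrite [RHS]mxE; rewrite !mxtens_indexK; rewrite !tensmxE mulrCA.
Qed.

Lemma Char_castmx n n' (e : n = n') (F : ball -> 'M[C]_n) :
  Char R m n F -> Char R m n' (fun S => castmx (e, e) (F S)).
Proof.
by case: n' / e => FC; congr (Char R m n _): FC; apply/funext => S; rewrite castmx_id.
Qed.

End Characteristic.

(** * Tensor products *)

Theorem theorem1p4 (R : realType) (m alpha beta : nat)
    (hm : (0 < m)%N) (halpha : (0 < alpha)%N) (hbeta : (0 < beta)%N)
    (F1 : matrix_ball R m -> 'M[R[i]%C]_alpha)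
    (F2 : matrix_ball R m -> 'M[R[i]%C]_beta)
    (hF1 : Char R m alpha F1) (hF2 : Char R m beta F2) :
  Char R m (alpha * beta)%N
    (fun S => castmx (mulnC beta alpha, mulnC beta alpha) (tens (F1 S) (F2 S))).
Proof.
apply: (@Char_castmx R m _ _ (mulnC beta alpha) (fun S => tens (F1 S) (F2 S))).
suff -> : (fun S => tens (F1 S) (F2 S)) =
    (fun S => (F2 S *t 1%:M) *m (1%:M *t F1 S)).
  by apply: Char_mul; [exact: Char_tens1|exact: Char_1tens].
by apply/funext => S; rewrite tensmx_mul mulmx1 mul1mx.
Qed.
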